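(* Let $w$ be a multilinear commutator word, $G$ a profinite group and $T$ a (closed) normal subgroup of $G$ such that every $w$-value of $G$ contained in $T$ is an FC-element of $G$. Then the $w^*$-residual of $T$ in $G$ has finite commutator subgroup.
   Context: Multilinear commutator words are defined recursively: $x$ is a multilinear commutator, and if $u,v$ are multilinear commutators in disjoint sets of variables then $[u,v]$ is one. An element $x\in G$ is an FC-element if its conjugacy class $x^G$ is finite. For a word $w=w(x_1,\dots,x_n)$, the marginal subgroup $w^*(G)$ is the set of all $x\in G$ such that $w(g_1,\dots,xg_i,\dots,g_n)=w(g_1,\dots,g_ix,\dots,g_n)=w(g_1,\dots,g_i,\dots,g_n)$ for all $g_1,\dots,g_n\in G$ and all $1\le i\le n$. For a subset $S$ of $G$, the $w^*$-residual of $S$ in $G$ is the intersection of all normal subgroups $N$ of $G$ such that $SN/N$ is contained in $w^*(G/N)$. *)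

(* Defs.v *)
From HB Require Import structures.
From mathcomp Require Import all_boot all_order.
From mathcomp Require Import all_classical topology.
Set Implicit Arguments. Unset Strict Implicit. Unset Printing Implicit Defensive.
Local Open Scope classical_set_scope.

Record is_group (G : Type) (mul : G -> G -> G) (inv : G -> G) (one : G) : Prop := {
  grp_mulA : forall x y z, mul x (mul y z) = mul (mul x y) z;
  grp_mul1 : forall x, mul one x = x;
  grp_mulV : forall x, mul (inv x) x = one }.

Record profinite_group := ProfiniteGroup {
  pg_car :> topologicalType;
  pg_mul : pg_car -> pg_car -> pg_car;
  pg_inv : pg_car -> pg_car;
  pg_one : pg_car;
  pg_group : is_group pg_mul pg_inv pg_one;
  pg_mul_cont : continuous (fun p : pg_car * pg_car => pg_mul p.1 p.2);
  pg_inv_cont : continuous pg_inv;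
  pg_compact : compact [set: pg_car];
  pg_hausdorff : hausdorff_space pg_car;
  pg_tdisc : totally_disconnected [set: pg_car] }.

Section Defs.
Variable G : profinite_group.
Local Notation mul := (@pg_mul G).
Local Notation inv := (@pg_inv G).
Local Notation one := (@pg_one G).

Definition gconj (x y : G) : G := mul (inv y) (mul x y).
Definition gcomm (x y : G) : G := mul (mul (inv x) (inv y)) (mul x y).

Definition is_subgroup (H : set G) : Prop :=
  H one /\ forall x y, H x -> H y -> H (mul x (inv y)).

Definition is_normal (H : set G) : Prop :=
  is_subgroup H /\ forall x y, H x -> H (gconj x y).

Definition gen (A : set G) : set G :=
  fun x => forall H, is_subgroup H -> A `<=` H -> H x.

Definition derived (A : set G) : set G :=
  gen (fun z => exists a b, A a /\ A b /\ z = gcomm a b).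

Definition FC_elem (x : G) : Prop := finite_set [set gconj x y | y in [set: G]].

End Defs.

Inductive cword := CVar of nat | CComm of cword & cword.

Fixpoint cvars (w : cword) : seq nat :=
  match w with CVar i => [:: i] | CComm u v => cvars u ++ cvars v end.

Fixpoint multilinear (w : cword) : bool :=
  match w with
  | CVar _ => true
  | CComm u v => [&& multilinear u, multilinear v &
                    all (fun i => i \notin cvars v) (cvars u)]
  end.

Fixpoint weval (G : profinite_group) (g : nat -> G) (w : cword) : G :=
  match w with
  | CVar i => g i
  | CComm u v => gcomm (weval g u) (weval g v)
  end.

Definition upd (G : profinite_group) (g : nat -> G) (i : nat) (x : G) : nat -> G :=
  fun j => if j == i then x else g j.

Section WDefs.
Variables (G : profinite_group) (w : cword).
Local Notation mul := (@pg_mul G).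
Local Notation inv := (@pg_inv G).

Definition wvalue (x : G) : Prop := exists g : nat -> G, weval g w = x.

(* SN/N is contained in the marginal subgroup w*(G/N); written out via the
   canonical projection G -> G/N: a = b in G/N iff a^-1 b in N. *)
Definition marginal_mod (S N : set G) : Prop :=
  forall s, S s -> forall (g : nat -> G) (i : nat), i \in cvars w ->
    N (mul (inv (weval (upd g i (mul s (g i))) w)) (weval g w)) /\
    N (mul (inv (weval (upd g i (mul (g i) s)) w)) (weval g w)).

Definition wstar_residual (S : set G) : set G :=
  fun x => forall N, is_normal N -> marginal_mod S N -> N x.

End WDefs.

(* Main.v *)
(* Modulo a normal subgroup N containing all w-values with an entry in T, the
   subgroup T is marginal; so the w*-residual lies in the subgroup R generated by
   these values. They belong to T, hence are FC-elements, and R is an FC-group.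
   For a in R, a Dietzmann type argument puts [R, a] in a finite normal subgroup.
   A Baire category argument gives a box of tuples on which the R-classes of the
   w-values have bounded size, and Neumann's argument with a class of maximal size
   makes all w-values of a smaller box central in R modulo a finite normal
   subgroup. Commutator calculus replaces cosets of an open normal subgroup U by
   U itself, and an induction on the number of entries not restricted to U extends
   this to all tuples, by compactness. *)
Require Import Defs.
From mathcomp Require Import all_boot all_order.
From mathcomp Require Import all_classical topology zify.
Set Implicit Arguments. Unset Strict Implicit. Unset Printing Implicit Defensive.
Local Open Scope classical_set_scope.

Declare Scope pg_scope.
Delimit Scope pg_scope with pg.
Notation "x * y" := (pg_mul x y) : pg_scope.
Notation "x ^-1" := (pg_inv x) : pg_scope.
Notation "1" := (pg_one _) : pg_scope.
Notation "x ^ y" := (gconj x y) : pg_scope.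
Local Open Scope pg_scope.

(** * Group identities and a normal form for group words *)

Section GroupLaws.
Variable G : profinite_group.
Implicit Types x y z : G.

Let grp := pg_group G.

Lemma pg_mulA x y z : x * (y * z) = x * y * z.
Proof. exact: grp_mulA grp x y z. Qed.
Lemma pg_mul1g x : 1 * x = x.
Proof. exact: grp_mul1 grp x. Qed.
Lemma pg_mulVg x : x^-1 * x = 1.
Proof. exact: grp_mulV grp x. Qed.
Lemma pg_mulKg x y : x^-1 * (x * y) = y.
Proof. by rewrite pg_mulA pg_mulVg pg_mul1g. Qed.
Lemma pg_mulgV x : x * x^-1 = 1.
Proof. by rewrite -[LHS](pg_mulKg x^-1) (pg_mulKg x) pg_mulVg. Qed.
Lemma pg_mulg1 x : x * 1 = x.
Proof. by rewrite -(pg_mulVg x) pg_mulA pg_mulgV pg_mul1g. Qed.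
Lemma pg_mulgK x y : x * y * y^-1 = x.
Proof. by rewrite -pg_mulA pg_mulgV pg_mulg1. Qed.
Lemma pg_mulgVK x y : x * y^-1 * y = x.
Proof. by rewrite -pg_mulA pg_mulVg pg_mulg1. Qed.
Lemma pg_mulgI x y z : x * y = x * z -> y = z.
Proof. by move=> e; rewrite -(pg_mulKg x y) e pg_mulKg. Qed.
Lemma pg_invgK x : x^-1^-1 = x.
Proof. by apply: (@pg_mulgI x^-1); rewrite pg_mulgV pg_mulVg. Qed.
Lemma pg_invg1 : 1^-1 = 1 :> G.
Proof. by rewrite -[LHS]pg_mul1g pg_mulgV. Qed.
Lemma pg_invMg x y : (x * y)^-1 = y^-1 * x^-1.
Proof. by apply: (@pg_mulgI (x * y)); rewrite pg_mulgV pg_mulA pg_mulgK pg_mulgV. Qed.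

End GroupLaws.

Definition pgE := (pg_mulA, pg_invMg, pg_invgK, pg_invg1, pg_mul1g, pg_mulg1,
  pg_mulgK, pg_mulgVK, pg_mulgV, pg_mulVg).

(* [pgE] is a complete rewriting system for free groups. *)
Ltac pg_group := rewrite /gcomm /gconj ?pgE.

(** * Normal subgroups and centralizers modulo them *)

Section Subgroups.
Variable G : profinite_group.
Implicit Types (x y z n : G) (H N S Z U F : set G).

Lemma subgroup1 H : is_subgroup H -> H 1. Proof. by case. Qed.

Lemma subgroupV H x : is_subgroup H -> H x -> H x^-1.
Proof. by case=> H1 HB Hx; rewrite -[x^-1]pg_mul1g; apply: HB. Qed.

Lemma subgroupM H x y : is_subgroup H -> H x -> H y -> H (x * y).
Proof.
by move=> sH Hx Hy; rewrite -[y]pg_invgK; apply: sH.2 => //; exact: subgroupV.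
Qed.

Lemma subgroupMl H x y : is_subgroup H -> H x -> H (x * y) -> H y.
Proof.
by move=> sH Hx Hxy; rewrite -(pg_mulKg x y); apply: subgroupM => //; exact: subgroupV.
Qed.

Lemma normalJ N x y : is_normal N -> N x -> N (x ^ y).
Proof. by case=> _; apply. Qed.

Lemma normal_comml N x y : is_normal N -> N x -> N (gcomm x y).
Proof.
move=> nN Nx; have -> : gcomm x y = x^-1 * x ^ y by pg_group.
by apply: subgroupM; [exact: nN.1|exact: subgroupV nN.1 _|exact: normalJ].
Qed.

Lemma normal_commr N x y : is_normal N -> N y -> N (gcomm x y).
Proof.
move=> nN Ny; have -> : gcomm x y = (gcomm y x)^-1 by pg_group.
by apply: subgroupV; [exact: nN.1|exact: normal_comml].
Qed.

Lemma normalT : is_normal [set: G]. Proof. by []. Qed.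

Lemma normalI N N' : is_normal N -> is_normal N' -> is_normal (N `&` N').
Proof.
move=> nN nN'; split; first split.
- by split; apply: subgroup1; [exact: nN.1|exact: nN'.1].
- by move=> x y [? ?] [? ?]; split; [apply: nN.1.2|apply: nN'.1.2].
- by move=> x y [? ?]; split; exact: normalJ.
Qed.

Lemma gen_subgroup (A : set G) : is_subgroup (gen A).
Proof.
split=> [H [] //|x y Ax Ay H sH AH].
by apply: sH.2; [exact: Ax|exact: Ay].
Qed.

Lemma sub_gen (A : set G) : A `<=` gen A.
Proof. by move=> x Ax H _; exact. Qed.

Lemma gen_normal (A : set G) : (forall x y, A x -> A (x ^ y)) -> is_normal (gen A).
Proof.
move=> AJ; split; first exact: gen_subgroup.
move=> x y Ax.
apply: (Ax (fun z => gen A (z ^ y))) => [|z Az]; last by apply: sub_gen; exact: AJ.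
split=> [|z t Az At].
  have -> : 1 ^ y = 1 :> G by pg_group.
  exact: subgroup1 (gen_subgroup A).
have -> : (z * t^-1) ^ y = z ^ y * (t ^ y)^-1 by pg_group.
by apply: (gen_subgroup A).2.
Qed.

Lemma derived_sub (A N : set G) : is_subgroup N ->
  (forall a b, A a -> A b -> N (gcomm a b)) -> derived A `<=` N.
Proof. by move=> sN AN x; apply=> // _ [a [b [Aa [Ab ->]]]]; exact: AN. Qed.

(** The centralizer of [S] modulo [Z], written with commutators in [G] so that no quotient is
    formed. *)
Definition centmod S Z : set G := [set n | forall y, S y -> Z (gcomm y n)].

Lemma centmod_normal S Z : is_normal Z -> (forall x y, S x -> S (x ^ y)) ->
  is_normal (centmod S Z).
Proof.
move=> nZ SJ; have sZ := nZ.1; split; first split.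
- move=> y _; have -> : gcomm y 1 = 1 by pg_group.
  exact: subgroup1.
- move=> n m Cn Cm y Sy.
  have -> : gcomm y (n * m^-1) = (gcomm y m ^ m^-1)^-1 * gcomm y n ^ m^-1 by pg_group.
  apply: subgroupM => //; last by apply: normalJ => //; exact: Cn.
  by apply: subgroupV => //; apply: normalJ => //; exact: Cm.
- move=> n g Cn y Sy.
  have -> : gcomm y (n ^ g) = gcomm (y ^ g^-1) n ^ g by pg_group.
  by apply: normalJ => //; apply: Cn; exact: SJ.
Qed.

Lemma centmodS S Z Z' : Z `<=` Z' -> centmod S Z `<=` centmod S Z'.
Proof. by move=> ZZ' n Cn y /Cn/ZZ'. Qed.

End Subgroups.

(** * Values of multilinear commutators *)

Section Words.
Variable G : profinite_group.
Implicit Types (g h : nat -> G) (V N Z : set G) (D : nat -> set G).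

Lemma eq_weval w g h : {in cvars w, g =1 h} -> weval g w = weval h w.
Proof.
elim: w => [i|u IHu v IHv] /= e; first by apply: e; rewrite inE.
by rewrite IHu ?IHv// => i iw; apply: e; rewrite mem_cat iw ?orbT.
Qed.

Lemma wevalJ w g x : weval (fun i => g i ^ x) w = weval g w ^ x.
Proof. by elim: w => [//|u /= -> v ->]; pg_group. Qed.

Lemma weval_normal w g N i : is_normal N -> i \in cvars w -> N (g i) ->
  N (weval g w).
Proof.
move=> nN + Ngi; elim: w => [j|u IHu v IHv] /=; first by rewrite inE => /eqP <-.
by rewrite mem_cat => /orP[/IHu|/IHv]; [exact: normal_comml|exact: normal_commr].
Qed.

Lemma multilinear_comm u v : multilinear (CComm u v) ->
  [/\ multilinear u, multilinear v, {in cvars u, forall i, i \notin cvars v} &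
     {in cvars v, forall i, i \notin cvars u}].
Proof.
move=> /= /and3P[mu mv /allP uv]; split => // i iv.
by apply/negP => /uv; rewrite iv.
Qed.

Lemma updE g i x : upd g i x i = x. Proof. by rewrite /upd eqxx. Qed.

Lemma weval_notin w g i x : i \notin cvars w -> weval (upd g i x) w = weval g w.
Proof.
move=> iw; apply: eq_weval => j jw; rewrite /upd; case: eqP => // ji.
by rewrite -ji jw in iw.
Qed.

(** The two halves of a multilinear commutator share no variable, so splicing turns independently
    chosen values of the halves into one value of the whole. *)
Definition splice (w : cword) g h : nat -> G := fun i => if i \in cvars w then g i else h i.

Lemma weval_splice w g h : weval (splice w g h) w = weval g w.
Proof. by apply: eq_weval => i iw; rewrite /splice iw. Qed.

Lemma weval_spliceC w w' g h : {in cvars w', forall i, i \notin cvars w} ->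
  weval (splice w g h) w' = weval h w'.
Proof. by move=> ww'; apply: eq_weval => i /ww' /negbTE iw; rewrite /splice iw. Qed.

(* [p, q m] differs from [p, q] by the commutator of m with p ^ q, which is again
   a value with entries in the normal sets D i. *)
Lemma weval_marginal w (D V : nat -> set G) Z : multilinear w ->
  (forall i, is_normal (D i)) -> (forall i, is_normal (V i)) -> is_normal Z ->
  (forall g i, (forall j, D j (g j)) -> i \in cvars w -> V i (g i) -> Z (weval g w)) ->
  forall g h, (forall j, D j (g j)) -> (forall j, D j (h j)) ->
    {in cvars w, forall j, V j ((g j)^-1 * h j)} ->
  Z ((weval g w)^-1 * weval h w).
Proof.
move=> + nD nV; elim: w Z => [i|u IHu v IHv] Z mw nZ DZ g h Dg Dh gh.
  rewrite /= -[_ * _](updE h i); apply: (DZ _ i) => /=; rewrite ?inE//.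
    move=> j; rewrite /upd; case: eqP => // ->.
    by apply: subgroupM (nD i).1 _ _ => //; exact: subgroupV (nD i).1 _.
  by rewrite updE; apply: gh; rewrite inE.
have [mu mv uv vu] := multilinear_comm mw; have sZ := nZ.1.
pose val t : set G := [set x | exists2 f : nat -> G, (forall j, D j (f j)) & weval f t = x].
have valJ t x y : val t x -> val t (x ^ y).
  move=> [f Df <-]; exists (fun i => f i ^ y); last exact: wevalJ.
  by move=> j; exact: normalJ.
have Dsplice t f f' : (forall j, D j (f j)) -> (forall j, D j (f' j)) ->
    forall j, D j (splice t f f' j).
  by move=> Df Df' j; rewrite /splice; case: ifP.
have VJ t x y : val t x^-1 -> val t (x ^ y)^-1.
  by move=> /valJ -/(_ y); pg_group.
(* A commutator with [n] first becomes one with [n] second after inverting the other entry, so [n]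
   is made to centralize the inverses of the values of [v]. *)
have {}IHu := IHu (centmod [set y | val v y^-1] Z) mu
  (centmod_normal nZ (VJ v)) _ g h Dg Dh.
have {}IHv := IHv (centmod (val u) Z) mv (centmod_normal nZ (valJ u)) _ g h Dg Dh.
set p := weval g u; set q := weval g v.
set n := (weval g u)^-1 * weval h u in IHu.
set m := (weval g v)^-1 * weval h v in IHv.
have {}IHu : centmod [set y | val v y^-1] Z n.
  apply: IHu => [f i Df iu Vi y [f' Df' fy]|j ju]; last first.
    by apply: gh; rewrite mem_cat ju.
  have := DZ (splice u f f') i (Dsplice u _ _ Df Df'); rewrite /= mem_cat iu /splice iu.
  rewrite -/(splice u f f') weval_splice weval_spliceC// fy => /(_ isT Vi) Zc.
  have -> : gcomm y (weval f u) = gcomm (weval f u) y^-1 ^ y by pg_group.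
  exact: normalJ.
have {}IHv : centmod (val u) Z m.
  apply: IHv => [f i Df iv Vi y [f' Df' fy]|j jv]; last first.
    by apply: gh; rewrite mem_cat jv orbT.
  have := DZ (splice u f' f) i (Dsplice u _ _ Df' Df); rewrite /= mem_cat iv orbT.
  rewrite weval_splice weval_spliceC// fy => /(_ isT); apply.
  by rewrite /splice (negbTE (vu _ iv)).
have hu : weval h u = p * n by rewrite /n /p; pg_group.
have hv : weval h v = q * m by rewrite /m /q; pg_group.
rewrite /= -/p -/q hu hv.
set q' := q * m.
have -> : (gcomm p q)^-1 * gcomm (p * n) q' =
    gcomm (p ^ q) m * gcomm ((q' ^ p)^-1) n ^ q' by rewrite /q'; pg_group.
apply: subgroupM => //.
  by apply: IHv; apply: valJ; exists g.
apply: normalJ => //; apply: IHu => /=; rewrite pg_invgK; apply: valJ.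
by exists h.
Qed.

(** Linearity in one entry holds only up to conjugation, as in [[p q, r] = [p, r] ^ q [q, r]]. The
    conjugators lie in [V], and those met inside the word are moved into the other entries. *)
Lemma weval_split w V g i x v : multilinear w -> is_normal V ->
  i \in cvars w -> V v ->
  exists h y, [/\ V y, forall j, exists2 z, V z & h j = g j ^ z &
    weval (upd g i (x * v)) w = weval (upd h i x) w ^ y * weval (upd g i v) w].
Proof.
move=> + nV; have sV := nV.1.
elim: w x v => [j|a IHa b IHb] x v mw + Vv.
  rewrite inE => /eqP ->; exists g, 1; split=> /=; first exact: subgroup1.
    by move=> k; exists 1; [exact: subgroup1|pg_group].
  by rewrite !updE; pg_group.
have [ma mb ab ba] := multilinear_comm mw.
rewrite /= mem_cat => /orP[ia|ib].
  have [h [y [Vy hg ->]]] := IHa x v ma ia Vv.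
  have ib := ab _ ia.
  rewrite !(weval_notin _ _ ib).
  set q := weval (upd g i v) a; set r := weval g b; set p := weval (upd h i x) a.
  have Vq : V q by apply: (@weval_normal _ _ _ i) => //; rewrite updE.
  (* Since [[p ^ y q, r] = [p, r ^ y^-1] ^ (y q) [q, r]], the entries of [b] are conjugated by
     [y^-1]. *)
  exists (splice a h (fun j => g j ^ y^-1)), (y * q); split; first exact: subgroupM.
    move=> j; rewrite /splice; case: ifP => _; first exact: hg.
    by exists y^-1 => //; exact: subgroupV.
  have -> : weval (upd (splice a h (fun j => g j ^ y^-1)) i x) a = p.
    by apply: eq_weval => j ja; rewrite /upd /splice ja.
  rewrite (weval_notin _ _ ib) weval_spliceC// wevalJ -/r.
  by pg_group.
have [h [y [Vy hg ->]]] := IHb x v mb ib Vv.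
have ia := ba _ ib.
rewrite !(weval_notin _ _ ia).
set q := weval (upd g i v) b; set r := weval g a; set p := weval (upd h i x) b.
have Vq : V q by apply: (@weval_normal _ _ _ i) => //; rewrite updE.
(* Here [[r, q]] comes out on the left; moving it to the right adds its inverse to the
   conjugator. *)
exists (splice b h (fun j => g j ^ y^-1)), (y * (q * (gcomm r q)^-1)); split.
- apply: subgroupM => //; apply: subgroupM => //; apply: subgroupV => //.
  exact: normal_commr.
- move=> j; rewrite /splice; case: ifP => _; first exact: hg.
  by exists y^-1 => //; exact: subgroupV.
have -> : weval (upd (splice b h (fun j => g j ^ y^-1)) i x) b = p.
  by apply: eq_weval => j ja; rewrite /upd /splice ja.
rewrite (weval_notin _ _ ia) weval_spliceC// wevalJ -/r.
by pg_group.
Qed.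

End Words.

(** * Dietzmann's lemma, FC-elements and finite normal subgroups *)

Section Finiteness.
Variable G : profinite_group.
Implicit Types (x y z : G) (S F R : set G) (s t : seq G).

Definition pgprod s : G := foldr (@pg_mul G) 1 s.

Lemma pgprod_cat s t : pgprod (s ++ t) = pgprod s * pgprod t.
Proof. by elim: s => [|x s IHs] /=; rewrite ?pg_mul1g// IHs pg_mulA. Qed.

Lemma pgprodJ s x : pgprod s ^ x = pgprod [seq y ^ x | y <- s].
Proof. by elim: s => [|y s IHs] /=; rewrite -?IHs; pg_group. Qed.

Definition words_in S s := forall x, x \in s -> S x.

Lemma words_in_cons S x s : words_in S (x :: s) <-> S x /\ words_in S s.
Proof.
split=> [Sxs|[Sx Ss] y]; last by rewrite inE => /predU1P[->//|/Ss].
by split=> [|y ys]; apply: Sxs; rewrite inE ?eqxx ?ys ?orbT.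
Qed.

Lemma words_in_cat S s t : words_in S s -> words_in S t -> words_in S (s ++ t).
Proof. by move=> Ss St x; rewrite mem_cat => /orP[/Ss|/St]. Qed.

Lemma words_in_nseq S k x : S x -> words_in S (nseq k x).
Proof. by move=> Sx y; rewrite mem_nseq => /andP[_ /eqP ->]. Qed.

Lemma size_le_sum_count (b : G -> nat) s t : {subset t <= s} ->
  {in s, forall x, count_mem x t <= b x} -> size t <= \sum_(x <- s) b x.
Proof.
elim: s t => [|x s IHs] t ts tb.
  by case: t ts {tb} => // y t /(_ y); rewrite mem_head => /(_ isT).
rewrite big_cons -(count_predC (pred1 x) t) leq_add//; first by apply: tb; rewrite mem_head.
rewrite -size_filter; apply: IHs => [y|y ys].
  by rewrite mem_filter => /andP[/= yx /ts]; rewrite inE (negbTE yx).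
apply: leq_trans (tb y _); last by rewrite inE ys orbT.
by rewrite count_filter; apply: sub_count => z /andP[].
Qed.

(** Pulling every [x] to the front conjugates the letters it passes, which stay in [S], and keeps
    the total length. *)
Lemma pgprod_collect S x s : (forall y z, S y -> S (y ^ z)) -> words_in S s ->
  exists t, [/\ words_in S t, size t = size s - count_mem x s &
    pgprod s = pgprod (nseq (count_mem x s) x ++ t)].
Proof.
move=> SJ; elim: s => [|y s IHs]; first by exists [::].
move=> /words_in_cons[Sy /IHs[t [St szt st]]] /=.
have [->|_] /= := eqVneq y x; first by exists t; split => //=; rewrite st.
exists (y ^ pgprod (nseq (count_mem x s) x) :: t); split.
- by apply/words_in_cons; split => //; exact: SJ.
- by rewrite /= szt add0n subSn// count_size.
- by rewrite st !pgprod_cat /=; pg_group.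
Qed.

Lemma finite_pgmul (A B : set G) : finite_set A -> finite_set B ->
  finite_set [set x | exists a b, [/\ A a, B b & x = a * b]].
Proof.
move=> fA fB; apply: sub_finite_set (finite_image (fun p => p.1 * p.2) (finite_setX fA fB)).
by move=> _ [a [b [Aa Bb ->]]]; exists (a, b).
Qed.

Lemma finite_words_le S n : finite_set S ->
  finite_set [set pgprod s | s in [set s | words_in S s /\ size s <= n]].
Proof.
move=> fS; elim: n => [|n IHn].
  apply: sub_finite_set (finite_set1 1) => _ [s [_ +] <-].
  by rewrite leqn0 => /nilP ->.
have fU := conj IHn (finite_pgmul fS IHn); rewrite -finite_setU in fU.
apply: sub_finite_set fU.
move=> _ [[|x s] [Ss szs] <-]; first by left; exists [::].
have [Sx {}Ss] := (words_in_cons _ _ _).1 Ss.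
by right; exists x, (pgprod s); split => //; exists s.
Qed.

(* A variant of Dietzmann's lemma: repeated letters of a word can be collected
   by conjugation, so long words can be shortened. *)
Lemma finite_gen S : finite_set S -> (forall x y, S x -> S (x ^ y)) ->
  (forall x, S x -> S x^-1) ->
  (forall x, S x -> exists2 t, words_in S t & pgprod (nseq (size t).+1 x) = pgprod t) ->
  finite_set (gen S).
Proof.
move=> fS SJ SV Sshort.
have /choice[t tP] : forall x, exists t,
    S x -> words_in S t /\ pgprod (nseq (size t).+1 x) = pgprod t.
  move=> x; have [/Sshort[t St xt]|nSx] := pselect (S x); first by exists t.
  by exists [::].
have [s0 Ss0] := (finite_seqP S).1 fS.
(* A word longer than [n] contains some letter [x] more than [size (t x)] times, enough to replace a
   block of [x] by the shorter [t x]. *)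
pose n := (\sum_(x <- s0) size (t x))%N.
have short s : words_in S s ->
    [set pgprod s | s in [set s | words_in S s /\ size s <= n]] (pgprod s).
  have [k] := ubnP (size s); elim: k s => // k IHk s ltk Ss.
  have [lesn|ltns] := leqP (size s) n; first by exists s.
  have [x xs ltx] : exists2 x, x \in s0 & size (t x) < count_mem x s.
    apply: contrapT => nx; move: ltns; rewrite ltnNge => /negP; apply.
    apply: size_le_sum_count => [x /Ss|x xs0]; first by rewrite Ss0.
    by rewrite leqNgt; apply/negP => ltx; apply: nx; exists x.
  have Sx : S x by rewrite Ss0.
  have [Stx xtx] := tP x Sx.
  have [u [Su szu ->]] := pgprod_collect x SJ Ss.
  have -> : pgprod (nseq (count_mem x s) x ++ u) =
      pgprod (t x ++ nseq (count_mem x s - (size (t x)).+1) x ++ u).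
    by rewrite -{1}(subnKC ltx) nseqD !pgprod_cat xtx pg_mulA.
  apply: IHk; last by do 2?[apply: words_in_cat => //]; exact: words_in_nseq.
  rewrite !size_cat size_nseq szu.
  have : (count_mem x s <= size s)%N by exact: count_size.
  by move: ltk ltx; lia.
apply: sub_finite_set (finite_words_le n fS) => x; apply; last first.
  move=> y Sy; rewrite -[y]pg_mulg1; apply: (short [:: y]).
  by apply/words_in_cons.
split=> [|y z [s [Ss _] <-] [s' [Ss' _] <-]]; first by apply: (short [::]).
have -> : (pgprod s')^-1 = pgprod (rev [seq y^-1 | y <- s']).
  elim: {Ss'} s' => [|y' s' IHs'] /=; first by pg_group.
  by rewrite rev_cons -cats1 pgprod_cat -IHs' /=; pg_group.
rewrite -pgprod_cat; apply: short; apply: words_in_cat => // y'.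
by rewrite mem_rev => /mapP[z' /Ss' Sz' ->]; exact: SV.
Qed.

(** Bounding lists of distinct conjugates makes failure of the bound a finite, hence open, condition
    on [x]. *)
Definition class_le R k x := forall s, words_in R s ->
  uniq [seq x ^ r | r <- s] -> size s <= k.

Lemma FC_class_le R x : FC_elem x -> exists k, class_le R k x.
Proof.
move=> /finite_seqP[t xt]; exists (size t) => s _ us.
rewrite -(size_map (gconj x)); apply: uniq_leq_size us _ => _ /mapP[r _ ->].
suff : [set` t] (x ^ r) by [].
by rewrite -xt; exists r.
Qed.

Lemma FC_subgroup : is_subgroup (@FC_elem G).
Proof.
split=> [|x y fx fy].
  apply: sub_finite_set (finite_set1 1) => _ [y _ <-] /=; by pg_group.
have fyV : finite_set [set z^-1 | z in [set y ^ r | r in [set: G]]].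
  exact: finite_image.
apply: sub_finite_set (finite_pgmul fx fyV) => _ [r _ <-].
exists (x ^ r), (y ^ r)^-1; split; [by exists r| |by pg_group].
by exists (y ^ r) => //; exists r.
Qed.

(** By pigeonhole two conjugates of [y] by powers of [x] coincide, and the quotient of these powers
    commutes with [y]. *)
Lemma FC_commute_pow x y : FC_elem y -> exists2 m, 0 < m &
  y * pgprod (nseq m x) = pgprod (nseq m x) * y.
Proof.
move=> /(FC_class_le setT)[k yk].
have : ~~ uniq [seq y ^ r | r <- [seq pgprod (nseq i x) | i <- iota 0 k.+1]].
  by apply/negP => /yk; rewrite size_map size_iota ltnn => /(_ (fun _ _ => I)).
case/(uniqPn 1) => i [j [ltij]]; rewrite size_map size_map size_iota => ltjk.
have ltik := ltn_trans ltij ltjk.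
rewrite !(nth_map 1) ?size_map ?size_iota// !(nth_map 0) ?size_iota// !nth_iota// !add0n.
rewrite -(subnK (ltnW ltij)) nseqD pgprod_cat.
set a := pgprod (nseq i x); set b := pgprod _ => e.
exists (j - i); first by rewrite subn_gt0.
rewrite -/b; have <- : b * y ^ b = y * b by pg_group.
have -> : y ^ b = (y ^ (b * a)) ^ a^-1 by pg_group.
by rewrite -e; pg_group.
Qed.

Definition finite_normal F := finite_set F /\ is_normal F.

(* With c = [x, y] and c ^ m commuting with y one has
   c ^ (m + 1) = [x, y ^ 2] [x ^ y, y] ^ (m - 1), which has m factors. *)
Lemma FC_comm_finite R x : is_normal R -> R `<=` @FC_elem G -> FC_elem x ->
  exists2 F, finite_normal F & forall r, R r -> F (gcomm x r).
Proof.
move=> nR RFC FCx; have sR := nR.1.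
(* All conjugates of [x] enter, to make [S] invariant under conjugation. *)
pose S : set G := [set z | exists y r, R r /\ z = gcomm (x ^ y) r].
have SJ z y : S z -> S (z ^ y).
  move=> [t [r [Rr ->]]]; exists (t * y), (r ^ y); split; first exact: normalJ.
  by pg_group.
exists (gen S); last first.
  move=> r Rr; apply: sub_gen; exists 1, r; split => //.
  by have -> : x ^ 1 = x by pg_group.
split; last exact: gen_normal.
apply: finite_gen => //.
(* As [[z, r] = z^-1 z ^ r], the set [S] lies in [A^-1 A]. *)
- pose A := [set x ^ y | y in [set: G]].
  have fA : finite_set A by [].
  have fAV : finite_set [set z^-1 | z in A] by exact: finite_image.
  apply: sub_finite_set (finite_pgmul fAV fA) => _ [y [r [Rr ->]]].
  exists (x ^ y)^-1, (x ^ (y * r)); split; [by exists (x ^ y) => //; exists y|by exists (y * r)|].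
  by pg_group.
- move=> _ [y [r [Rr ->]]]; exists (y * r), r^-1; split; first exact: subgroupV.
  by pg_group.
move=> _ [y [r [Rr ->]]].
have [[//|m] _] := FC_commute_pow (gcomm (x ^ y) r) (RFC _ Rr).
set c := gcomm (x ^ y) r => rc.
exists (gcomm (x ^ y) (r * r) :: nseq m (c ^ r)).
  apply/words_in_cons; split.
    by exists y, (r * r); split => //; exact: subgroupM.
  by apply: words_in_nseq; apply: SJ; exists y, r.
have -> : nseq m (c ^ r) = [seq z ^ r | z <- nseq m c] by rewrite map_nseq.
rewrite /= size_map size_nseq -pgprodJ /=.
set b := pgprod (nseq m c); have {}rc : r * (c * b) = c * b * r := rc.
have -> : c * (c * b) = (x ^ y)^-1 * r^-1 * (x ^ y) * (r * (c * b)).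
  by rewrite /c; pg_group.
by rewrite rc /c; pg_group.
Qed.

Lemma finite_normal1 : finite_normal [set (1 : G)].
Proof.
split; first exact: finite_set1.
split; first by split=> // x y -> ->; pg_group.
by move=> x y ->; pg_group.
Qed.

Lemma finite_normalM F F' : finite_normal F -> finite_normal F' ->
  exists2 F'', finite_normal F'' & F `|` F' `<=` F''.
Proof.
move=> [fF nF] [fF' nF'].
exists [set x | exists a b, [/\ F a, F' b & x = a * b]]; last first.
  move=> x [Fx|Fx]; [exists x, 1|exists 1, x]; split => //; rewrite ?pg_mulg1 ?pg_mul1g//.
  - exact: subgroup1 nF'.1.
  - exact: subgroup1 nF.1.
split; first exact: finite_pgmul.
split; first split.
- by exists 1, 1; split; rewrite ?pg_mulg1//; [exact: subgroup1 nF.1|exact: subgroup1 nF'.1].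
- move=> _ _ [a [b [Fa Fb ->]]] [c [d [Fc Fd ->]]].
  exists (a * c^-1), ((b * d^-1) ^ c^-1); split.
  + exact: nF.1.2.
  + by apply: normalJ => //; exact: nF'.1.2.
  + by pg_group.
- move=> _ y [a [b [Fa Fb ->]]]; exists (a ^ y), (b ^ y).
  by split; [exact: normalJ|exact: normalJ|pg_group].
Qed.

End Finiteness.

(* The intersection Q of the clopen neighbourhoods of x is connected: a
   separation of Q extends, by normality and compactness, to a clopen
   neighbourhood of x. *)
Lemma totally_disconnected_zero_dimensional (T : topologicalType) :
  compact [set: T] -> hausdorff_space T -> totally_disconnected [set: T] ->
  zero_dimensional T.
Proof.
move=> cT hT tdT x y xy; apply: contrapT => nU.
pose Q := \bigcap_(D in [set D : set T | D x /\ clopen D]) D.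
have Qx : Q x by move=> D [].
have Qy : Q y.
  by move=> D [Dx cD]; apply: contrapT => nDy; apply: nU; exists D.
have cQ : closed Q by apply: closed_bigI => D [_ []].
suff Qconn : connected Q.
  have : connected_component [set: T] x y by exists Q.
  by rewrite tdT// => yx; rewrite yx eqxx in xy.
move=> B [b Bb] [O oO BO] [C cC BC].
have cB : closed B by rewrite BC; exact: closedI.
(* [B] is open in [Q], so the rest of [Q] is closed and normality separates it from [B]. *)
have oE : open (~` (Q `\` B)).
  have -> : ~` (Q `\` B) = ~` Q `|` O.
    rewrite setDE setCI setCK BO; apply/seteqP; split=> z.
      by move=> [?|[_ ?]]; [left|right].
    by move=> [?|Oz]; [left|have [Qz|?] := pselect (Q z); [right|left]].
  by apply: openU => //; exact: closed_openC.
have [V BV VE] : filter_from (set_nbhs B) closure (~` (Q `\` B)).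
  apply: (compact_normal hT cT) => // z Bz.
  by apply: open_nbhs_nbhs; split => // -[].
have BV0 : B `<=` interior V by move=> z /BV.
(* [K] is the boundary of [V] and misses [Q]; by compactness a single clopen neighbourhood [D] of
   [x] already misses it. *)
pose K := ~` (interior V `|` ~` closure V).
have cK : closed K.
  apply: open_closedC; apply: openU; first exact: open_interior.
  by apply: closed_openC; exact: closed_closure.
have [D [Dx [oD clD]] DK] : exists2 D : set T, D x /\ clopen D & D `<=` ~` K.
  apply: contrapT => nD.
  pose F := filter_from [set D : set T | D x /\ clopen D] (fun D => D `&` K).
  have FF : ProperFilter F.
    apply: filter_from_proper; last first.
      move=> D DD; apply: contrapT => /set0P/negP/negPn/eqP DK0; apply: nD.
      by exists D => // z Dz Kz; have : set0 z by rewrite -DK0.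
    apply: filter_from_filter; first by exists setT; split=> //; exact: clopenT.
    move=> A A' [? ?] [? ?]; exists (A `&` A') => [|z [[? ?] ?] //].
    by split => //; exact: clopenI.
  have FK : F K by exists setT; [split=> //; exact: clopenT|move=> z []].
  have [z [Kz Fz]] := subclosed_compact cK cT (@subsetT _ _) FF FK.
  have Qz : Q z.
    move=> D [Dx cD]; rewrite (closure_id D).1; last exact: cD.2.
    by move=> W zW; apply: Fz => //; exists D => // t [].
  apply: Kz; have [Bz|nBz] := pselect (B z); first by left; exact: BV0.
  by right=> /VE; apply.
have DVc z : D z -> interior V z \/ ~ closure V z.
  by move=> /DK; rewrite /K setCK.
(* Off the boundary, the interior and the exterior of [V] cut [D] into two clopen pieces. *)
have clDV : clopen (D `&` interior V).
  split; first by apply: openI => //; exact: open_interior.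
  have -> : D `&` interior V = D `&` closure V.
    apply/seteqP; split=> z [Dz Vz]; split => //.
      by apply: subset_closure; exact: interior_subset.
    by have [] := DVc z Dz.
  by apply: closedI => //; exact: closed_closure.
have clDW : clopen (D `&` ~` closure V).
  split; first by apply: openI => //; apply: closed_openC; exact: closed_closure.
  have -> : D `&` ~` closure V = D `&` ~` interior V.
    apply/seteqP; split=> z [Dz Vz]; split => //.
      by move=> Vz'; apply: Vz; apply: subset_closure; exact: interior_subset.
    by have [] := DVc z Dz.
  by apply: closedI => //; apply: open_closedC; exact: open_interior.
(* The piece containing [x] contains [Q]: inside [V] this forces [Q = B], outside it contradicts
   [b]. *)
case: (DVc x Dx) => [Vx|nVx].
  apply/seteqP; split=> [z|z Qz]; first by rewrite BO => -[].
  have [_ Vz] : (D `&` interior V) z by exact: Qz.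
  apply: contrapT => nBz.
  have := VE z (subset_closure (interior_subset Vz)); by apply.
have [_ nVb] : (D `&` ~` closure V) b.
  by have : Q b by [rewrite BO in Bb; case: Bb]; apply.
by case: nVb; apply: subset_closure; apply: interior_subset; exact: BV0.
Qed.

(** * Open normal subgroups of a profinite group *)

Section Topology.
Variable G : profinite_group.
Implicit Types (x y z r : G) (U V F R : set G).

Lemma pg_continuousM (T : topologicalType) (f g : T -> G) :
  continuous f -> continuous g -> continuous (fun t => f t * g t).
Proof.
move=> cf cg t; apply: (@continuous_comp _ _ _ (fun t => (f t, g t)) (fun p => p.1 * p.2)).
  by apply: cvg_pair; [exact: cf|exact: cg].
exact: pg_mul_cont.
Qed.

Lemma pg_continuousV (T : topologicalType) (f : T -> G) :
  continuous f -> continuous (fun t => (f t)^-1).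
Proof.
move=> cf t; apply: (@continuous_comp _ _ _ f (@pg_inv G)); first exact: cf.
exact: pg_inv_cont.
Qed.

Let cst_cts (T : topologicalType) (a : G) : continuous (fun _ : T => a).
Proof. by move=> t; exact: cvg_cst. Qed.
Let id_cts : continuous (fun x : G => x).
Proof. by move=> x; exact: cvg_id. Qed.

Lemma continuous_mull (a : G) : continuous (fun x => a * x).
Proof. by apply: pg_continuousM => //; exact: cst_cts. Qed.

Lemma continuous_conjl r : continuous (fun x : G => x ^ r).
Proof. by do !apply: pg_continuousM. Qed.

Lemma continuous_conjr x : continuous (fun r : G => x ^ r).
Proof. by do !apply: pg_continuousM => //; exact: pg_continuousV. Qed.

Lemma open_coset U a : open U -> open [set x | U (a^-1 * x)].
Proof.
move=> oU; apply: (@open_comp _ _ (fun x => a^-1 * x)) => // x _.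
exact: continuous_mull.
Qed.

Definition open_normal U := open U /\ is_normal U.

Lemma open_normalT : open_normal setT.
Proof. by split; [exact: openT|exact: normalT]. Qed.

Lemma open_normalI U V : open_normal U -> open_normal V -> open_normal (U `&` V).
Proof. by move=> [oU nU] [oV nV]; split; [exact: openI|exact: normalI]. Qed.

Lemma closed_coset U a : open_normal U -> closed [set x | U (a^-1 * x)].
Proof.
move=> [oU nU]; rewrite -[X in closed X]setCK; apply: open_closedC.
rewrite openE => x /= nUx; have := open_coset x oU; rewrite openE => /(_ x).
rewrite /= pg_mulVg => /(_ (subgroup1 nU.1)); apply: filterS => y /= Uxy Uay.
apply: nUx; have -> : a^-1 * x = a^-1 * y * (x^-1 * y)^-1 by pg_group.
exact: nU.1.2.
Qed.

(* For K clopen, the h with K (x y) <-> K (x h y) for all x, y form a normal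
   subgroup, open by compactness. *)
Lemma open_normal_basis (A : set G) : nbhs (1 : G) A ->
  exists2 U, open_normal U & U `<=` A.
Proof.
move=> A1.
have zdG := totally_disconnected_zero_dimensional (@pg_compact G)
  (@pg_hausdorff G) (@pg_tdisc G).
have [K [K1 [oK cK]] KA] := zero_dimensional_cvg (@pg_hausdorff G) zdG (@pg_compact G) A1.
pose N : set G := [set h | forall x y, K (x * y) <-> K (x * h * y)].
have nN : is_normal N.
  split; first split.
  - by move=> x y; rewrite pg_mulg1.
  - move=> g h Ng Nh x y.
    have := Ng x (h^-1 * y); have := Nh (x * g * h^-1) y.
    have := Nh (x * h^-1) y; pg_group => e1 e2 e3.
    by split => [/e1/e3|/e3/e1].
  - move=> h g Nh x y; have := Nh (x * g^-1) (g * y); by pg_group.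
exists N; last by move=> h /(_ 1 1); rewrite !pg_mulg1 pg_mul1g => /iffLR/(_ K1)/KA.
split => //.
have N1 : \forall h \near (1 : G), N h.
  pose P h (p : G * G) := K (p.1 * p.2) <-> K (p.1 * h * p.2).
  have /compact_near_coveringP cGG := compact_setX (@pg_compact G) (@pg_compact G).
  have : \forall h \near (1 : G), [set: G] `*` [set: G] `<=` P h.
    apply: cGG => -[x y] _.
    (* Near [((x, y), 1)] both products, with and without [h] inserted, lie on the same side of the
       clopen [K]. *)
    pose f (q : (G * G) * G) := q.1.1 * q.2 * q.1.2.
    pose f0 (q : (G * G) * G) := q.1.1 * q.1.2.
    have cfst : continuous (fun q : (G * G) * G => q.1.1).
      by move=> q; apply: cvg_comp; [exact: cvg_fst|exact: cvg_fst].
    have csnd : continuous (fun q : (G * G) * G => q.1.2).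
      by move=> q; apply: cvg_comp; [exact: cvg_fst|exact: cvg_snd].
    have cf : continuous f.
      by do !apply: pg_continuousM => //; move=> q; exact: cvg_snd.
    have cf0 : continuous f0 by exact: pg_continuousM.
    have ff0 : f ((x, y), 1) = f0 ((x, y), 1) by rewrite /f /f0 /= pg_mulg1.
    have near_eq (A' : set G) : open A' -> A' (x * y) ->
        (forall q, (f @^-1` A') q -> (f0 @^-1` A') q -> P q.2 q.1) ->
        nbhs ((x, y), 1 : G) [set q | P q.2 q.1].
      rewrite openE => oA' A'xy A'P; have nA' := oA' _ A'xy.
      have h1 : nbhs ((x, y), 1 : G) (f @^-1` A') by apply: cf; rewrite ff0.
      have h2 : nbhs ((x, y), 1 : G) (f0 @^-1` A') by apply: cf0.
      by apply: filterS2 h1 h2.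
    have [Kxy|nKxy] := pselect (K (x * y)); first by apply: (near_eq K).
    by apply: (near_eq (~` K)) => //; exact: closed_openC.
  by apply: filterS => h Ph x y; exact: (Ph (x, y)).
rewrite openE => h Nh.
have hN : nbhs h [set y | N (h^-1 * y)].
  by apply: (@continuous_mull h^-1 h N); rewrite pg_mulVg.
by apply: filterS hN => y Ny; have := subgroupM nN.1 Nh Ny; pg_group.
Qed.

(** Compactness, in near-covering form, is applied to the filter of finite lists under inclusion:
    near each point it is enough that the list contains that point. *)
Lemma open_normal_cosets U : open_normal U ->
  exists s : seq G, forall x, exists2 r, r \in s & U (r^-1 * x).
Proof.
move=> [oU nU].
pose F := filter_from [set: seq G] (fun s => [set t : seq G | {subset s <= t}]).
have FF : Filter F.
  apply: filter_from_filter; first by exists [::].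
  move=> s t _ _; exists (s ++ t) => // u stu.
  by split=> x xs; apply: stu; rewrite mem_cat xs ?orbT.
pose P (s : seq G) x := exists2 r, r \in s & U (r^-1 * x).
have /compact_near_coveringP/(_ _ _ P FF) := @pg_compact G.
case=> [x _|s _ /(_ s (fun _ => id)) Us]; last by exists s => x; exact: Us.
exists ([set y | U (x^-1 * y)], [set t : seq G | x \in t]); last first.
  by case=> y t [/= Uxy xt]; exists x.
split=> /=; last by exists [:: x] => // t; apply; rewrite mem_head.
apply: open_nbhs_nbhs; split; first exact: open_coset.
by rewrite /= pg_mulVg; exact: subgroup1 nU.1.
Qed.

(** [r] is isolated in its finite class, so by continuity conjugators near [1] fix it. *)
Lemma open_normal_FC r : FC_elem r -> exists2 U, open_normal U & forall u, U u -> r ^ u = r.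
Proof.
move=> FCr; apply: open_normal_basis.
pose A := [set r ^ u | u in [set: G]] `\ r.
have cA : closed A.
  have : finite_set A by apply: sub_finite_set FCr => x [].
  exact: (accessible_finite_set_closed.1 (hausdorff_accessible (@pg_hausdorff G))).
have : nbhs 1 [set u | (~` A) (r ^ u)].
  apply: (@continuous_conjr r 1 (~` A)).
  apply: open_nbhs_nbhs; split; first exact: closed_openC.
  by move=> [_]; apply; pg_group.
apply: filterS => u /= nAu.
by apply: contrapT => ru; apply: nAu; split => //; exists u.
Qed.

Lemma open_normal_FCs (s : seq G) : (forall r, r \in s -> FC_elem r) ->
  exists2 U, open_normal U & forall u r, U u -> r \in s -> r ^ u = r.
Proof.
elim: s => [_|r s IHs FCs]; first by exists setT => //; exact: open_normalT.
have [U oU Us] := IHs (fun r' sr' => FCs r' (mem_behead (s := r :: s) sr')).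
have [V oV Vr] := open_normal_FC (FCs r (mem_head _ _)).
exists (U `&` V); first exact: open_normalI.
by move=> u t [Uu Vu]; rewrite inE => /predU1P[->|/Us]; [exact: Vr|exact].
Qed.

Lemma open_conj_uniq (s : seq G) x : uniq [seq x ^ r | r <- s] ->
  \forall y \near x, uniq [seq y ^ r | r <- s].
Proof.
elim: s => [_|r s IHs /= /andP[xr /IHs us]]; first exact: nearW.
suff h : \forall y \near x, y ^ r \notin [seq y ^ r' | r' <- s].
  by apply: filterS (filterI h us) => y [-> ->].
elim: s xr {IHs us} => [_|t s IHs]; first exact: nearW.
rewrite /= inE negb_or => /andP[xt /IHs h].
suff h' : \forall y \near x, y ^ r != y ^ t.
  by apply: filterS (filterI h h') => y [h1 h2]; rewrite inE negb_or h2.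
have := @pg_hausdorff G; rewrite open_hausdorff => /(_ _ _ xt).
move=> [[A B] /= [xA xB] [oA oB AB]].
have {}xA : nbhs (x ^ r) A by apply: open_nbhs_nbhs; split => //; exact: set_mem.
have {}xB : nbhs (x ^ t) B by apply: open_nbhs_nbhs; split => //; exact: set_mem.
have hA : nbhs x [set y | A (y ^ r)] by apply: (@continuous_conjl r).
have hB : nbhs x [set y | B (y ^ t)] by apply: (@continuous_conjl t).
apply: filterS (filterI hA hB) => y [/= yA yB].
apply/eqP => e; have : (A `&` B) (y ^ r) by split; rewrite ?e // -e.
by rewrite (eqP AB).
Qed.

(** Lower semicontinuity of the class size: a list of distinct conjugates stays distinct near
    [x]. *)
Lemma open_class_gt R k x : ~ class_le R k x ->
  exists2 U, open_normal U & forall y, U (x^-1 * y) -> ~ class_le R k y.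
Proof.
move=> nk; have [s [Rs us ks]] : exists s, [/\ words_in R s,
    uniq [seq x ^ r | r <- s] & k < size s].
  apply: contrapT => ns; apply: nk => s Rs us.
  by rewrite leqNgt; apply/negP => ks; apply: ns; exists s.
have xu := open_conj_uniq us.
have [U oU Us] : exists2 U, open_normal U & U `<=` [set y | uniq [seq (x * y) ^ r | r <- s]].
  apply: open_normal_basis.
  apply: (@continuous_mull x 1 [set y | uniq [seq y ^ r | r <- s]]).
  by rewrite pg_mulg1.
exists U => // y /Us /=; rewrite pg_mulA pg_mulgV pg_mul1g => uy yk.
by have := yk s Rs uy; rewrite leqNgt ks.
Qed.

End Topology.

(** * Boxes of tuples: Baire category and Neumann's argument *)

Section Boxes.
Variables (G : profinite_group) (w : cword).
Hypothesis mw : multilinear w.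
Implicit Types (a b g h : nat -> G) (U V F R Z : set G) (D : nat -> set G).

Definition in_dom D g := forall j, D j (g j).
Definition in_box U a g := forall j, U ((a j)^-1 * g j).

Lemma in_box_refl U a : is_normal U -> in_box U a a.
Proof. by move=> nU j; rewrite pg_mulVg; exact: subgroup1 nU.1. Qed.

Lemma in_box_trans U b a g : is_normal U -> in_box U a b -> in_box U b g -> in_box U a g.
Proof.
by move=> nU ab bg j; have := subgroupM nU.1 (ab j) (bg j); pg_group.
Qed.

Lemma weval_box U a g : is_normal U -> in_box U a g ->
  U ((weval a w)^-1 * weval g w).
Proof.
move=> nU ag; apply: (@weval_marginal _ _ (fun _ => setT) (fun _ => U)) => // f i _ iw.
exact: weval_normal.
Qed.

(** A cluster point of the sequence lies in every closed set containing a tail. *)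
Lemma nested_limit (x : nat -> G) (A : nat -> set G) : (forall n, closed (A n)) ->
  (forall n m, n <= m -> A n (x m)) -> exists c, forall n, A n c.
Proof.
move=> cA Ax.
have [c [_ xc]] := @pg_compact G (x @ \oo) _ filterT.
exists c => n; rewrite (closure_id (A n)).1// => B cB; apply: xc => //.
by exists n => // m /= nm; exact: Ax.
Qed.

(* Baire category argument, for the cover of a box by the closed sets of the g
   such that the R-class of w(g) has at most k elements. *)
Lemma box_class_le R D a U : (forall j, closed (D j)) -> open_normal U ->
  (forall g, in_dom D g -> FC_elem (weval g w)) -> in_dom D a ->
  exists b V k, [/\ in_dom D b, in_box U a b, open_normal V, V `<=` U &
    forall g, in_dom D g -> in_box V b g -> class_le R k (weval g w)].
Proof.
move=> cD oU DFC Da; apply: contrapT => nex.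
pose good (p : (nat -> G) * set G) :=
  [/\ in_dom D p.1, in_box U a p.1, open_normal p.2 & p.2 `<=` U].
have /choice[f fP] : forall kp : nat * ((nat -> G) * set G), exists q, good kp.2 ->
    [/\ good q, in_box kp.2.2 kp.2.1 q.1, q.2 `<=` kp.2.2 &
        forall h, in_box q.2 q.1 h -> ~ class_le R kp.1 (weval h w)].
  move=> [k [b V]]; have [[/= Db ab oV VU]|ng] := pselect (good (b, V)); last by exists (b, V).
  have [g [Dg bg gk]] : exists g, [/\ in_dom D g, in_box V b g & ~ class_le R k (weval g w)].
    apply: contrapT => ng; apply: nex; exists b, V, k; split => // g Dg bg.
    by apply: contrapT => gk; apply: ng; exists g.
  have [W oW gW] := open_class_gt gk.
  exists (g, V `&` W) => _; split => //=.
  - split => //=.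
    + by apply: in_box_trans ab _ => [|j]; [exact: oU.2|exact: VU].
    + exact: open_normalI.
    + by move=> x [/VU].
  - move=> h gh; apply: gW; apply: weval_box; first exact: oW.2.
    by move=> j; case: (gh j).
(* The box at stage [n + 1] lies in the previous one, and all its values violate the bound [n]. *)
pose s := fix s n := if n is n.+1 then f (n, s n) else (a, U).
have sg n : good (s n).
  elim: n => [|n /(fP (n, s n))[]//].
  by split => //=; exact: in_box_refl oU.2.
have sS n := fP (n, s n) (sg n).
have sub n m : n <= m -> (s m).2 `<=` (s n).2.
  elim: m => [|m IHm]; first by rewrite leqn0 => /eqP ->.
  rewrite leq_eqVlt => /predU1P[->//|/IHm sub_nm].
  by have [_ _ sSm _] := sS m; exact: subset_trans sub_nm.
have box n m : n <= m -> in_box (s n).2 (s n).1 (s m).1.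
  have sN m' : is_normal (s m').2 by have [_ _ []] := sg m'.
  elim: m => [|m IHm]; first by rewrite leqn0 => /eqP ->; exact: in_box_refl.
  rewrite leq_eqVlt => /predU1P[->|lenm]; first exact: in_box_refl.
  apply: in_box_trans (IHm lenm) _ => // j; apply: (sub n m) => //.
  by have [_ + _ _] := sS m; exact.
have /choice[c cP] : forall j, exists c,
    forall n, (D j `&` [set x | (s n).2 (((s n).1 j)^-1 * x)]) c.
  move=> j; apply: (@nested_limit (fun n => (s n).1 j)) => [n|n m nm].
    by apply: closedI; [exact: cD|apply: closed_coset; case: (sg n)].
  by split; [case: (sg m) => /(_ j)|exact: box].
have Dc : in_dom D c by move=> j; case: (cP j 0).
(* The limit tuple [c] lies in all boxes, yet its value is FC and obeys some bound [k], against
   stage [k + 1]. *)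
have [k ck] := FC_class_le R (DFC c Dc).
have [_ _ _ nck] := sS k; apply: (nck c _ ck) => j.
by case: (cP j k.+1).
Qed.

Lemma bounded_max (P : nat -> Prop) k : P 0 -> (forall n, P n -> n <= k) ->
  exists2 n, P n & forall m, P m -> m <= n.
Proof.
move=> P0 Pk; have ex : exists n, `[< P n >] by exists 0; apply/asboolP.
have bd n : `[< P n >] -> n <= k by move=> /asboolP; exact: Pk.
case: (ex_maxnP ex bd) => n /asboolP Pn nmax; exists n => // m Pm.
by apply: nmax; apply/asboolP.
Qed.

(* Neumann's argument: if x = w(b) has an R-class of maximal size x^r1, ..., x^rn
   in the box, and v centralizes the r_i, then every conjugate of x v by R is one
   of the x^ri v, so [R, x v] lies in the normal closure of [R, x]. *)
Lemma box_central R D a U : is_normal R -> R `<=` @FC_elem G ->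
  (forall j, closed (D j)) -> open_normal U ->
  (forall g, in_dom D g -> FC_elem (weval g w)) -> in_dom D a ->
  exists b V F, [/\ in_dom D b, in_box U a b, open_normal V, V `<=` U &
    finite_normal F /\
    forall g, in_dom D g -> in_box V b g -> centmod R F (weval g w)].
Proof.
move=> nR RFC cD oU DFC Da.
have [b0 [V0 [k [Db0 ab0 oV0 V0U bk]]]] := box_class_le R cD oU DFC Da.
pose P n := exists g s, [/\ in_dom D g, in_box V0 b0 g, words_in R s,
  uniq [seq weval g w ^ r | r <- s] & size s = n].
have [||n [b [s [Db b0b Rs us sn]]] nmax] := @bounded_max P k.
- by exists b0, [::]; split => //; exact: in_box_refl oV0.2.
- by move=> n [g [s [Dg bg Rs us <-]]]; exact: bk Rs us.
set x := weval b w in us.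
have [F fF Fx] := FC_comm_finite nR RFC (DFC b Db).
have [V1 oV1 V1s] := open_normal_FCs (fun r sr => RFC r (Rs r sr)).
exists b, (V0 `&` V1), F; split => //.
- by apply: in_box_trans ab0 _ => [|j]; [exact: oU.2|exact: V0U].
- exact: open_normalI.
- by move=> y [/V0U].
split=> // g Dg bg r Rr.
have b0g : in_box V0 b0 g.
  by apply: in_box_trans b0b _ => [|j]; [exact: oV0.2|case: (bg j)].
set y := weval g w; set v := x^-1 * y.
have V1v : V1 v.
  by apply: weval_box; [exact: oV1.2|move=> j; case: (bg j)].
have yE : y = x * v by rewrite /v; pg_group.
have ys t : t \in s -> y ^ t = x ^ t * v.
  move=> st; have tv := V1s v t V1v st.
  have -> : x ^ t * v = t^-1 * x * v * t ^ v by pg_group.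
  by rewrite tv yE; pg_group.
(* Otherwise [y ^ r] and the [x ^ t * v] would exceed the maximal number of distinct conjugates. *)
have : y ^ r \in [seq y ^ t | t <- s].
  apply/negPn/negP => yr; suff : n < n by rewrite ltnn.
  apply: nmax; exists g, (r :: s); split => //=; last by rewrite sn.
    by apply/words_in_cons.
  rewrite yr /=.
  have -> : [seq y ^ t | t <- s] = [seq z * v | z <- [seq x ^ t | t <- s]].
    by rewrite -map_comp; apply/eq_in_map => t /ys.
  by rewrite map_inj_uniq// => z z' e; rewrite -(pg_mulgK z v) e pg_mulgK.
move=> /mapP[t st yrt].
(* From [y ^ r = x ^ t * v] follows [y^-1 * y ^ r = [x, t] ^ v]. *)
have -> : gcomm r y = ((gcomm x t) ^ v)^-1.
  have -> : gcomm r y = (y^-1 * y ^ r)^-1 by pg_group.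
  by rewrite yrt ys// yE; pg_group.
apply: subgroupV; first exact: fF.2.1.
by apply: normalJ; [exact: fF.2|apply: Fx; exact: Rs].
Qed.

(** Cosets of [V] are traded for [V] one entry at a time. By [weval_split] the value with entry
    [b i * g i] is a conjugate of one with entry [b i] times the wanted one, and the first two lie
    in [Z] by induction. *)
Lemma box_to_subgroup D b V Z (s : seq nat) : (forall j, is_normal (D j)) -> is_normal V ->
  is_normal Z -> in_dom D b ->
  (forall g, in_dom D g -> in_box V b g -> Z (weval g w)) ->
  forall g, in_dom D g -> (forall j, j \in s -> V (g j)) ->
    (forall j, j \notin s -> V ((b j)^-1 * g j)) -> Z (weval g w).
Proof.
move=> nD nV nZ Db DZ; elim: s => [|i s IHs] g Dg gV gb.
  by apply: DZ => // j; exact: gb.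
have [si|si] := boolP (i \in s).
  apply: IHs => // j js; first by apply: gV; rewrite inE js orbT.
  by apply: gb; rewrite inE negb_or js andbT; apply: contraNneq js => ->.
have Dupd f x : in_dom D f -> D i x -> in_dom D (upd f i x).
  by move=> Df Dx j; rewrite /upd; case: eqP => [->|_].
have IH f x : in_dom D f -> D i x -> V ((b i)^-1 * x) ->
    (forall j, j != i -> j \in s -> V (f j)) ->
    (forall j, j != i -> j \notin s -> V ((b j)^-1 * f j)) ->
    Z (weval (upd f i x) w).
  move=> Df Dx bx fV fb; apply: IHs => [|j js|j js]; first exact: Dupd.
    have ji : j != i by apply: contraNneq si => <-.
    by rewrite /upd (negbTE ji); exact: fV.
  by rewrite /upd; case: eqP => [->//|/eqP ji]; exact: fb.
have V1 := subgroup1 nV.1.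
have gV' j : j != i -> j \in s -> V (g j).
  by move=> _ js; apply: gV; rewrite inE js orbT.
have gb' j : j != i -> j \notin s -> V ((b j)^-1 * g j).
  by move=> ji js; apply: gb; rewrite inE negb_or ji.
have Vgi : V (g i) by apply: gV; rewrite mem_head.
have [iw|iw] := boolP (i \in cvars w); last first.
  rewrite -(weval_notin g (b i) iw); apply: IH => //.
  by rewrite pg_mulVg.
have [h [y [Vy hg e]]] := weval_split g (b i) mw nV iw Vgi.
have -> : weval g w = weval (upd g i (g i)) w.
  by apply: eq_weval => j _; rewrite /upd; case: eqP => [->|].
have : Z (weval (upd g i (b i * g i)) w).
  apply: IH => //; first exact: subgroupM (nD i).1 _ _.
  by rewrite pg_mulKg.
rewrite e; apply: subgroupMl => //; first exact: nZ.1.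
apply: normalJ => //; apply: IH => //.
- by move=> j; have [z _ ->] := hg j; exact: normalJ.
- by rewrite pg_mulVg.
- by move=> j ji js; have [z _ ->] := hg j; apply: normalJ => //; exact: gV'.
- move=> j ji js; have [z Vz ->] := hg j.
  have -> : (b j)^-1 * g j ^ z = (b j)^-1 * g j * gcomm (g j) z by pg_group.
  by apply: subgroupM nV.1 (gb' j ji js) _; exact: normal_commr.
Qed.

(** Finitely many choices are combined by intersecting the [U] and multiplying the [F]. *)
Lemma uniform_seq (T : eqType) (Q : set G -> set G -> T -> Prop) (s : seq T) :
  (forall U U' F F' x, U' `<=` U -> F `<=` F' -> Q U F x -> Q U' F' x) ->
  (forall x, x \in s -> exists U F, [/\ open_normal U, finite_normal F & Q U F x]) ->
  exists U F, [/\ open_normal U, finite_normal F & forall x, x \in s -> Q U F x].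
Proof.
move=> mono; elim: s => [_|x s IHs Qs].
  by exists setT, [set 1]; split; [exact: open_normalT|exact: finite_normal1|].
have [|U [F [oU fF UF]]] := IHs; first by move=> y ys; apply: Qs; rewrite inE ys orbT.
have [U' [F' [oU' fF' UF']]] := Qs x (mem_head _ _).
have [F'' fF'' FF''] := finite_normalM fF fF'.
exists (U `&` U'), F''; split => //; first exact: open_normalI.
move=> y; rewrite inE => /predU1P[->|/UF yUF].
  by apply: mono UF'; [exact: subIsetr|apply: subset_trans FF''; exact: subsetUr].
by apply: mono yUF; [exact: subIsetl|apply: subset_trans FF''; exact: subsetUl].
Qed.

(** [P] sees the entries in [J] only through their finitely many cosets of [U0], so choices made per
    tuple become uniform, one entry of [J] at a time. *)
Lemma uniform_cosets (P : set G -> set G -> (nat -> G) -> Prop) (J : seq nat) U0 :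
  open_normal U0 ->
  (forall U U' F F' g, U' `<=` U -> F `<=` F' -> P U F g -> P U' F' g) ->
  (forall U F g h, (forall j, j \in J -> U0 ((g j)^-1 * h j)) -> P U F g -> P U F h) ->
  (forall g, exists U F, [/\ open_normal U, finite_normal F & P U F g]) ->
  exists U F, [/\ open_normal U, finite_normal F & forall g, P U F g].
Proof.
move=> oU0; have U01 := subgroup1 oU0.2.1.
elim: J P => [|i J IHJ] P mono inv ex.
  have [U [F [oU fF PUF]]] := ex (fun _ => 1).
  by exists U, F; split => // g; apply: inv PUF.
have [s sU0] := open_normal_cosets oU0.
have [||g|U [F [oU fF PUF]]] := IHJ (fun U F g => forall x, P U F (upd g i x)).
- by move=> U U' F F' g UU' FF' PUF x; exact: mono (PUF x).
- move=> U F g h gh PUF x; apply: inv (PUF x) => j; rewrite /upd inE.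
  by case: eqP => [_ _|_ /= /gh//]; rewrite pg_mulVg.
- have [||U [F [oU fF PUF]]] := @uniform_seq _ (fun U F r => P U F (upd g i r)) s.
  + by move=> U U' F F' r; exact: mono.
  + by move=> r _; exact: ex.
  exists U, F; split => // x; have [r rs U0r] := sU0 x.
  apply: inv (PUF r rs) => j _; rewrite /upd.
  by case: eqP => // _; rewrite pg_mulVg.
exists U, F; split => // g; apply: inv (PUF g (g i)) => j _; rewrite /upd.
by case: eqP => [->|_]; rewrite pg_mulVg.
Qed.

(** * Induction on the unrestricted entries *)

Section Central.
Variables (R : set G) (D : nat -> set G).
Hypotheses (nR : is_normal R) (RFC : R `<=` @FC_elem G).
Hypotheses (nD : forall j, is_normal (D j)) (cD : forall j, closed (D j)).
Hypothesis DFC : forall g, in_dom D g -> FC_elem (weval g w).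

Let nC F : finite_normal F -> is_normal (centmod R F).
Proof. by move=> fF; apply: centmod_normal fF.2 _ => x y; exact: normalJ. Qed.

Lemma values_central (J : seq nat) : exists U F, [/\ open_normal U, finite_normal F &
  forall g, in_dom D g -> (forall j, j \notin J -> U (g j)) -> centmod R F (weval g w)].
Proof.
have [n] := ubnP (size J); elim: n J => // n IHn J ltJn.
(* By induction, values are central modulo [F0] once some entry of [J] and all entries outside [J]
   lie in [U0]. *)
pose Q U F i := forall g, in_dom D g ->
  (forall j, (j == i) || (j \notin J) -> U (g j)) -> centmod R F (weval g w).
have [||U0 [F0 [oU0 fF0 Q0]]] := @uniform_seq _ Q J.
- move=> U U' F F' i U'U FF' UF g Dg gU; apply: centmodS FF' _ _.
  by apply: UF => // j ji; apply: U'U; exact: gU.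
- move=> i iJ; have [|U [F [oU fF UF]]] := IHn [seq j <- J | predC1 i j].
    rewrite -ltnS; apply: leq_trans ltJn; rewrite ltnS size_filter -(count_predC (pred1 i) J).
    by rewrite -[X in X < _]add0n ltn_add2r -has_count has_pred1.
  exists U, F; split => // g Dg gU; apply: UF => // j.
  by rewrite mem_filter /= negb_and negbK; exact: gU.
pose P U F g := forall h, in_dom D h ->
  (forall j, j \in J -> U0 ((g j)^-1 * h j)) -> (forall j, j \notin J -> U (h j)) ->
  centmod R F (weval h w).
have U01 := subgroup1 oU0.2.1.
suff [U [F [oU fF PUF]]] : exists U F, [/\ open_normal U, finite_normal F & forall g, P U F g].
  exists U, F; split => // g Dg gU; apply: (PUF g) => // j _.
  by rewrite pg_mulVg.
apply: (@uniform_cosets P J U0) => //.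
- move=> U U' F F' g U'U FF' PUF h Dh gh hU'; apply: centmodS FF' _ _.
  by apply: PUF => // j /hU'/U'U.
- move=> U F g g' gg' PUF h Dh gh hU; apply: PUF => // j jJ.
  by have := subgroupM oU0.2.1 (gg' j jJ) (gh j jJ); pg_group.
move=> g.
have [[h0 Dh0 gh0]|nh0] := pselect (exists2 h0, in_dom D h0 &
    forall j, j \in J -> U0 ((g j)^-1 * h0 j)); last first.
  exists setT, [set 1]; split; [exact: open_normalT|exact: finite_normal1|].
  by move=> h Dh gh _; case: nh0; exists h.
pose a j := if j \in J then h0 j else 1.
have Da : in_dom D a.
  by move=> j; rewrite /a; case: ifP => // _; exact: subgroup1 (nD j).1.
have [b [V [F1 [Db ab oV VU0 [fF1 bV]]]]] := box_central nR RFC cD oU0 DFC Da.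
have [F fF FF] := finite_normalM fF0 fF1.
have F0F : F0 `<=` F by apply: subset_trans FF; exact: subsetUl.
have F1F : F1 `<=` F by apply: subset_trans FF; exact: subsetUr.
exists V, F; split => // h Dh gh hV.
(* The value at [h1] is central by [box_to_subgroup], and [h] differs from [h1] only on [J], by
   elements of [U0]. *)
pose h1 j := if j \in J then b j else h j.
have Ch1 : centmod R F (weval h1 w).
  apply: (centmodS F1F).
  (* Indices foreign to [w] receive the entries of [b], which keeps them in the box. *)
  have -> : weval h1 w = weval (splice w h1 b) w by rewrite weval_splice.
  apply: (@box_to_subgroup D b V _ [seq j <- cvars w | j \notin J])
    => // [||j|j|j]; [exact: oV.2|exact: nC| | |].
  - by rewrite /splice /h1; case: ifP => // _; case: ifP.
  - by rewrite mem_filter /splice /h1 => /andP[jJ ->]; rewrite (negbTE jJ); exact: hV.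
  - rewrite mem_filter negb_and negbK /splice /h1.
    case: ifP => [_|_ _]; last by rewrite pg_mulVg; exact: subgroup1 oV.2.1.
    by rewrite orbF => ->; rewrite pg_mulVg; exact: subgroup1 oV.2.1.
have sC := (nC fF).1.
apply: (subgroupMl sC (subgroupV sC Ch1)).
(* An entry in [V' j] gives a central value: on [J] by [Q0], elsewhere because the entry, and hence
   the value, is [1]. *)
pose D' j := if j \in J then D j else D j `&` V.
pose V' j := if j \in J then D j `&` U0 else [set 1].
apply: (@weval_marginal _ _ D' V') => //.
- by move=> j; rewrite /D'; case: ifP => // _; apply: normalI => //; exact: oV.2.
- move=> j; rewrite /V'; case: ifP => _; last exact: (finite_normal1 G).2.
  by apply: normalI => //; exact: oU0.2.
- exact: nC.
- move=> f i D'f iw; rewrite /V'; case: ifP => [iJ [Df U0f]|_ f1]; last first.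
    have -> : weval f w = 1 by exact: (@weval_normal _ w f [set 1] i (finite_normal1 G).2).
    exact: subgroup1.
  apply: (centmodS F0F); apply: (Q0 i) => // j.
    by have := D'f j; rewrite /D'; case: ifP => // _ [].
  case: eqP => [->//|_ /= jJ].
  by have := D'f j; rewrite /D' (negbTE jJ) => -[_ /VU0].
- move=> j; rewrite /D' /h1; case: ifP => // /negbT jJ.
  by split; [|exact: hV].
- move=> j; rewrite /D'; case: ifP => // /negbT jJ.
  by split; [|exact: hV].
move=> j _; rewrite /V' /h1; case: ifP => [jJ|_]; last by rewrite pg_mulVg.
split; first by apply: subgroupM (nD j).1 _ _ => //; exact: subgroupV (nD j).1 _.
have abj := ab j; rewrite /a jJ in abj.
have -> : (b j)^-1 * h j = ((h0 j)^-1 * b j)^-1 * (((g j)^-1 * h0 j)^-1 * ((g j)^-1 * h j)).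
  by pg_group.
have sU0 := oU0.2.1.
apply: subgroupM (subgroupV sU0 abj) (subgroupM sU0 (subgroupV sU0 _) _) => //.
  exact: gh0.
exact: gh.
Qed.

End Central.

End Boxes.

(** * The residual and its commutator subgroup *)

Theorem theorem4p3 (w : cword) (G : profinite_group) (T : set G) :
  multilinear w ->
  closed T -> is_normal T ->
  (forall x : G, wvalue w x -> T x -> FC_elem x) ->
  finite_set (derived (wstar_residual w T)).
Proof.
move=> mw cT nT TFC.
pose A : set G := [set x | exists g i, [/\ i \in cvars w, T (g i) & weval g w = x]].
pose R := gen A.
have AFC : A `<=` @FC_elem G.
  move=> _ [g [i [iw Tgi <-]]]; apply: TFC; first by exists g.
  exact: weval_normal iw Tgi.
have nR : is_normal R.
  apply: gen_normal => _ y [g [i [iw Tgi <-]]].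
  exists (fun j => g j ^ y), i; split => //; first exact: normalJ.
  exact: wevalJ.
have RFC : R `<=` @FC_elem G by move=> x; apply=> //; exact: FC_subgroup.
have resR : wstar_residual w T `<=` R.
  (* [R] is one of the groups intersected in the residual: changing entries by elements of [T]
     changes a value by an element of [R]. *)
  move=> x; apply=> // t Tt g i iw.
  have T1 := subgroup1 nT.1; have TtV := subgroupV nT.1 Tt.
  have M f : (forall j, T ((f j)^-1 * g j)) -> R ((weval f w)^-1 * weval g w).
    move=> fg; apply: (@weval_marginal _ _ (fun _ => setT) (fun _ => T)) => // f' j _ jw Tj.
    by apply: sub_gen; exists f', j.
  split; apply: M => j; rewrite /upd; case: eqP => [->|_]; rewrite ?pg_mulVg//.
    by have := normalJ (g i) nT TtV; pg_group.
  by pg_group.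
(* For each variable [i] the domain has [T] at entry [i] and all of [G] elsewhere; one [F] then
   serves all variables. *)
have [||U [F [oU [fF nF] UF]]] := @uniform_seq G _
    (fun _ F i => forall g, T (g i) -> centmod R F (weval g w)) (cvars w).
- move=> U U' F F' i _ FF' TF g Tgi; apply: centmodS FF' _ _; exact: TF.
- move=> i iw; pose D j : set G := if j == i then T else setT.
  have [j|j|g Dg|U [F [oU fF UF]]] := @values_central _ w mw R D nR RFC _ _ _ (cvars w).
  + by rewrite /D; case: ifP => // _; exact: normalT.
  + by rewrite /D; case: ifP => // _; exact: closedT.
  + apply: AFC; exists g, i; split => //.
    by have := Dg i; rewrite /D eqxx.
  exists U, F; split => // g Tgi.
  (* All variables of [w] are free here, so the restriction to [U] concerns only foreign indices,
     which are filled with [1]. *)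
  rewrite -(weval_splice w g (fun _ => 1)); apply: UF => j.
    rewrite /splice /D; case: eqP => // ->; rewrite iw //.
  by rewrite /splice => /negbTE ->; exact: subgroup1 oU.2.1.
(* The generators of [R] centralize [R] modulo [F], hence so does [R]. *)
have RC : R `<=` centmod R F.
  move=> x; apply=> [|_ [g [i [iw Tgi <-]]]]; last exact: UF iw g Tgi.
  by apply: (centmod_normal nF _).1 => x' y; exact: normalJ.
apply: sub_finite_set fF; apply: derived_sub nF.1 _ => x y /resR Rx /resR Ry.
exact: RC.
Qed.
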